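(* Suppose the Main MDS Conjecture holds. Let $q$ be a prime power and suppose there is a $q$-ary Singleton-optimal $[n,k,d;r]$-locally repairable code with $r\ge2$, $r<k$, $n\ge2(r+1)$, $d\ge3$ and $k\not\equiv1\pmod r$. Then: (i) if $k$ is a constant, then $n\le q+O(1)$ (the $O(1)$ being bounded by a constant depending only on $k$); (ii) if $d=\lambda n$ for some real $0<\lambda<1$, then $n\le\frac q\lambda+O(1)$ (the $O(1)$ being bounded by a constant depending only on $\lambda$).
   Context: An $[n,k,d;r]$-locally repairable code over $\mathbb{F}_q$ is a linear code $\mathcal{C}\subseteq\mathbb{F}_q^n$ of dimension $k$ and minimum Hamming distance $d$ with locality $r$: for every $i\in[n]=\{1,\dots,n\}$ there is $I_i\subseteq[n]\setminus\{i\}$ with $|I_i|\le r$ such that any two codewords agreeing on $I_i$ also agree at $i$. For linear codes this is equivalent to: for every $i\in[n]$ there is $\mathbf{c}\in\mathcal{C}^\perp$ with $i\in\mathrm{supp}(\mathbf{c})$ and $|\mathrm{supp}(\mathbf{c})|\le r+1$. Such a code always satisfies $d\le n-k-\lceil k/r\rceil+2$ (Singleton-type bound) and is called Singleton-optimal if equality holds. Main MDS Conjecture: an $[n,k]$ linear code over $\mathbb{F}_q$ is MDS if its minimum distance is $n-k+1$, and nontrivial if $k\notin\{0,1,n-1,n\}$; the conjecture asserts that every nontrivial $[n,k]$ MDS code over $\mathbb{F}_q$ has $n\le q+2$ if $q$ is even and $k=3$ or $k=q-1$, and $n\le q+1$ otherwise. *)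

(* Defs.v *)
From HB Require Import structures.
From mathcomp Require Import all_boot all_order all_algebra.
From mathcomp Require Import reals.

Set Implicit Arguments.
Unset Strict Implicit.
Unset Printing Implicit Defensive.

Import Order.TTheory GRing.Theory Num.Theory.
Local Open Scope ring_scope.

Definition hamming_dist (F : finFieldType) (n : nat) (x y : 'rV[F]_n) : nat :=
  #|[set i : 'I_n | x 0 i != y 0 i]|.

(* Relational, so that a code with at most one codeword has no minimum
   distance instead of a conventional one. *)
Definition min_distance (F : finFieldType) (n : nat)
    (C : {vspace 'rV[F]_n}) (d : nat) : Prop :=
  (forall x y, x \in C -> y \in C -> x != y -> (d <= hamming_dist x y)%N) /\
  (exists x y, [/\ x \in C, y \in C, x != y & hamming_dist x y = d]).

Definition has_locality (F : finFieldType) (n : nat)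
    (C : {vspace 'rV[F]_n}) (r : nat) : Prop :=
  forall i : 'I_n, exists I : {set 'I_n},
    [/\ i \notin I, (#|I| <= r)%N &
      forall x y, x \in C -> y \in C ->
        (forall j, j \in I -> x 0 j = y 0 j) -> x 0 i = y 0 i].

Definition locally_repairable (F : finFieldType) (n k d r : nat)
    (C : {vspace 'rV[F]_n}) : Prop :=
  [/\ \dim C = k, min_distance C d & has_locality C r].

(* Equality is stated in [int] to avoid truncated subtraction. *)
Definition singleton_optimal (n k d r : nat) : Prop :=
  d%:Z = n%:Z - k%:Z - Num.ceil (k%:R / r%:R : rat) + 2.

(* No truncation in [n - k]: [k] is the dimension of a subspace of [F^n]. *)
Definition is_MDS (F : finFieldType) (n k : nat)
    (C : {vspace 'rV[F]_n}) : Prop :=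
  \dim C = k /\ min_distance C (n - k + 1).

Definition nontrivial_dim (n k : nat) : Prop :=
  [/\ k <> 0%N, k <> 1%N, k <> (n - 1)%N & k <> n].

Definition main_MDS_conjecture : Prop :=
  forall (F : finFieldType) (n k : nat) (C : {vspace 'rV[F]_n}),
    is_MDS k C -> nontrivial_dim n k ->
    (n <= if ~~ odd #|F| && ((k == 3) || (k == #|F| - 1))
          then #|F| + 2 else #|F| + 1)%N.

(* Main.v *)
(* Put j = ceil(k/r) - 1.  Greedily take j repair groups, each time around a
   coordinate at which some codeword vanishing on the previous groups is
   nonzero.  On their union S, of size at most j(r+1), the restricted code has
   dimension at most |S| - j, so the subcode vanishing on S has dimension at least
   k - |S| + j.  Since d = n - k - j + 1, this shortened code of length n - |S|
   meets the Singleton bound: it is MDS with distance d.  Its dimension is at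
   least k - jr, which is at least 2 because k is not 1 modulo r; together with
   d >= 3 this makes it nontrivial.  The conjecture gives n - |S| <= q + 2, which
   is (i), and d + 1 <= n - |S| <= q + 2, which is (ii). *)

Require Import Defs.
From HB Require Import structures.
From mathcomp Require Import all_boot all_order all_algebra.
From mathcomp Require Import reals.
From mathcomp Require Import zify.

Set Implicit Arguments.
Unset Strict Implicit.
Unset Printing Implicit Defensive.

Import Order.TTheory GRing.Theory Num.Theory.
Local Open Scope ring_scope.

Section Shortening.
Variable F : finFieldType.

Lemma dimv_row n (U : {vspace 'rV[F]_n}) : (\dim U <= n)%N.
Proof.
apply: leq_trans (dimvS (subvf U)) _.
by rewrite dimvf leq_eqVlt [X in X == _]mul1n eqxx.
Qed.

Definition restrict n (A : {set 'I_n}) : 'Hom('rV[F]_n, 'rV[F]_#|A|) :=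
  linfun (colsub (@enum_val _ (mem A))).

(** The zeroed coordinates are kept, so iterated shortenings live in one ambient space;
    [restrict (~: A)] deletes them later. *)
Definition shorten n (C : {vspace 'rV[F]_n}) (A : {set 'I_n}) :=
  (C :&: lker (restrict A))%VS.

Lemma restrictE n (A : {set 'I_n}) v j : restrict A v 0 j = v 0 (enum_val j).
Proof. by rewrite lfunE mxE. Qed.

Lemma shortenP n (C : {vspace 'rV[F]_n}) (A : {set 'I_n}) v :
  reflect (v \in C /\ forall i, i \in A -> v 0 i = 0) (v \in shorten C A).
Proof.
rewrite memv_cap memv_ker; apply: (iffP andP) => -[-> v0]; split=> //.
  move=> i Ai; move/eqP/rowP/(_ (enum_rank_in Ai i)): v0.
  by rewrite restrictE enum_rankK_in // mxE.
by apply/eqP/rowP => j; rewrite restrictE v0 ?mxE // enum_valP.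
Qed.

Lemma dim_shorten n (C : {vspace 'rV[F]_n}) (A : {set 'I_n}) :
  (\dim C <= \dim (shorten C A) + #|A|)%N.
Proof.
rewrite -(limg_ker_dim (restrict A) C) leq_add2l.
exact: dimv_row.
Qed.

Lemma shortenU n (C : {vspace 'rV[F]_n}) (A B : {set 'I_n}) :
  shorten (shorten C A) B = shorten C (A :|: B).
Proof.
apply/vspaceP => v; apply/shortenP/shortenP => [[/shortenP[Cv vA] vB]|[Cv vAB]].
  by split=> // i; rewrite inE => /orP[/vA|/vB].
split=> [|i Bi]; last by apply: vAB; rewrite inE Bi orbT.
by apply/shortenP; split=> // i Ai; apply: vAB; rewrite inE Ai.
Qed.

Lemma shorten_setD n (C : {vspace 'rV[F]_n}) (A B : {set 'I_n}) :
  shorten (shorten C A) (B :\: A) = shorten C (A :|: B).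
Proof. by rewrite shortenU setDE setUIr setUCr setIT. Qed.

Lemma hamming_dist_restrict n (C : {vspace 'rV[F]_n}) (S : {set 'I_n}) u v :
    u \in shorten C S -> v \in shorten C S ->
  hamming_dist (restrict (~: S) u) (restrict (~: S) v) = hamming_dist u v.
Proof.
move=> /shortenP[_ u0] /shortenP[_ v0].
rewrite /hamming_dist -(card_imset _ (@enum_val_inj _ (mem (~: S)))).
congr #|pred_of_set _|; apply/setP => i; rewrite inE; apply/imsetP/idP.
  by case=> j; rewrite inE !restrictE => uv ->.
move=> uv; have Si : i \in ~: S.
  by rewrite inE; apply: contraNN uv => Si; rewrite u0 ?v0.
by exists (enum_rank_in Si i); rewrite ?inE ?restrictE enum_rankK_in.
Qed.

Lemma hamming_dist_eq0 n (x y : 'rV[F]_n) : (hamming_dist x y == 0)%N = (x == y).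
Proof.
rewrite cards_eq0; apply/eqP/eqP => [/setP xy|->].
  by apply/rowP => i; have:= xy i; rewrite !inE => /negbFE/eqP.
by apply/setP => i; rewrite !inE eqxx.
Qed.

Lemma singleton_bound n (C : {vspace 'rV[F]_n}) : (0 < \dim C)%N ->
  exists x y, [/\ x \in C, y \in C, x != y &
                  (hamming_dist x y + \dim C <= n + 1)%N].
Proof.
move=> C_gt0; have leCn := dimv_row C.
(* Vanishing on [\dim C - 1] coordinates still leaves a nonzero codeword, which is then compared
   with 0. *)
have [A cardA] : exists A : {set 'I_n}, #|A| = (\dim C).-1.
  exists [set widen_ord (leq_trans (leq_pred _) leCn) i | i : 'I_(\dim C).-1].
  by rewrite card_imset ?card_ord // => i j /(congr1 val)/= /val_inj.
have shA_gt0 : shorten C A != 0%VS.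
  by rewrite -dimv_eq0; have:= dim_shorten C A; rewrite cardA; lia.
have /shortenP[Cx xA] := memv_pick (shorten C A).
exists (vpick (shorten C A)), 0; split; rewrite ?mem0v ?vpick0 //.
have : (hamming_dist (vpick (shorten C A)) 0 <= #|~: A|)%N.
  apply/subset_leq_card/subsetP => i; rewrite !inE mxE.
  by apply: contraNN => /xA ->.
by have:= cardsC A; rewrite card_ord cardA; move: #|~: A| (hamming_dist _ _); lia.
Qed.

(** The bound on [j * r] says that [j - 1] groups, costing at most [r] dimensions each, do not
    exhaust [C], so a nonzero codeword remains when the last group is chosen. *)
Lemma repair_groups n (C : {vspace 'rV[F]_n}) r j :
    has_locality C r -> (j * r < \dim C + r)%N ->
  exists S : {set 'I_n},
    (#|S| <= j * (r + 1))%N /\ (\dim C + j <= \dim (shorten C S) + #|S|)%N.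
Proof.
move=> locC; elim: j => [_|j IHj ltj].
  by exists set0; rewrite cards0 addn0; have:= dim_shorten C set0; rewrite cards0.
have [|S [cardS dimS]] := IHj; first by lia.
have shS_neq0 : shorten C S != 0%VS by rewrite -dimv_eq0; nia.
have /shortenP[Cx xS] := memv_pick (shorten C S).
have [i xi] : exists i, vpick (shorten C S) 0 i != 0.
  apply/existsP; rewrite -vpick0 in shS_neq0; apply: contraNT shS_neq0.
  by move=> /existsPn x0; apply/eqP/rowP => i; rewrite mxE; apply/eqP/negPn/x0.
have [I [Ii cardI repI]] := locC i.
have Si : i \notin S :|: I.
  by rewrite inE negb_or Ii andbT; apply: contraNN xi => /xS ->.
exists (i |: (S :|: I)); rewrite cardsU1 Si.
(* Comparing with the zero codeword, vanishing on [I] forces vanishing at [i]: this coordinate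
   enlarges the set at no cost in dimension. *)
have -> : shorten C (i |: (S :|: I)) = shorten C (S :|: I).
  rewrite setUC -(shortenU C (S :|: I)); apply/vspaceP => v.
  apply/shortenP/idP => [[]//|v0]; split=> // _ /set1P->.
  case/shortenP: v0 => Cv v0.
  rewrite (repI v 0) ?mem0v ?mxE // => l Il.
  by rewrite v0 ?mxE // inE Il orbT.
(* Only the coordinates of [I] outside [S] are charged, as groups may overlap. *)
have := dim_shorten (shorten C S) (I :\: S); rewrite shorten_setD.
have := cardsD I S; have := cardsUI S I; have := subset_leq_card (subsetIr S I).
by rewrite (setIC I); nia.
Qed.

(** Deleting zero coordinates preserves distances, hence also dimension; the cardinality hypothesis
    is the reverse of the Singleton bound, so both are equalities. *)
Lemma shorten_MDS n (C : {vspace 'rV[F]_n}) (S : {set 'I_n}) d :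
    (forall x y, x \in C -> y \in C -> x != y -> (d <= hamming_dist x y)%N) ->
    (0 < \dim (shorten C S))%N ->
    (#|~: S| < \dim (shorten C S) + d)%N ->
  let C' := (restrict (~: S) @: shorten C S)%VS in
  [/\ \dim C' = \dim (shorten C S), is_MDS (\dim C') C' &
      (#|~: S| + 1 = \dim C' + d)%N].
Proof.
move=> distC sh_gt0 leCd C'.
have dimC' : \dim C' = \dim (shorten C S).
  apply/limg_dim_eq/eqP; rewrite -subv0; apply/subvP => v.
  rewrite memv_cap memv_ker => /andP[Sv /eqP v0]; rewrite memv0.
  by rewrite -hamming_dist_eq0 -(hamming_dist_restrict Sv (mem0v _)) v0 linear0
     hamming_dist_eq0.
have distC' x y : x \in C' -> y \in C' -> x != y -> (d <= hamming_dist x y)%N.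
  move=> /memv_imgP[u Su ->] /memv_imgP[v Sv ->] uv.
  rewrite (hamming_dist_restrict Su Sv) distC //.
  - by case/shortenP: Su.
  - by case/shortenP: Sv.
  - by apply: contraNN uv => /eqP->.
have [|x [y [C'x C'y xy dxy]]] := @singleton_bound _ C'; first by rewrite dimC'.
have ledxy := distC' x y C'x C'y xy.
have [dE hE] : (#|~: S| + 1 = \dim C' + d)%N /\ hamming_dist x y = d.
  move: leCd dxy ledxy; rewrite -dimC'.
  by move: #|~: S| (hamming_dist x y) (\dim C'); lia.
rewrite /is_MDS; have -> : (#|~: S| - \dim C' + 1 = d)%N.
  by move: dE (dimv_row C'); move: #|~: S| (\dim C'); lia.
by do 3![split=> //]; exists x, y.
Qed.

End Shortening.

Lemma ceil_divn (k r : nat) : (0 < k)%N -> (0 < r)%N ->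
  Num.ceil (k%:R / r%:R : rat) = (k.-1 %/ r).+1%:Z.
Proof.
move=> k_gt0 r_gt0; apply: ceil_def.
have r_gt0' : (0 : rat) < r%:R by rewrite ltr0n.
rewrite ltr_pdivlMr // ler_pdivrMr // -addn1 PoszD addrK.
rewrite -PoszD -!pmulrn -!natrM ltr_nat ler_nat.
have := divn_eq k.-1 r; have := ltn_pmod k.-1 r_gt0; nia.
Qed.

Lemma singleton_optimal_bounds (hMDS : main_MDS_conjecture) (F : finFieldType)
    (n k d r : nat) (C : {vspace 'rV[F]_n}) :
    locally_repairable k d r C -> singleton_optimal n k d r ->
    (2 <= r)%N -> (r < k)%N -> (3 <= d)%N -> k <> 1 %[mod r] ->
  (n <= #|F| + (2 * k + 2))%N /\ (d <= #|F| + 1)%N.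
Proof.
move=> [dimC [distC _] locC] opt r_ge2 ltrk d_ge3 kN1.
have r_gt0 : (0 < r)%N by lia.
move: opt; rewrite /singleton_optimal ceil_divn //; last by lia.
set j := (k.-1 %/ r)%N => opt.
(* In general [j * r <= k - 1], with equality exactly when [k] is 1 modulo [r]. *)
have lejk : (j * r + 2 <= k)%N.
  have lej := leq_divM k.-1 r; rewrite -/j in lej.
  have [//|gtj] := leqP (j * r + 2) k.
  case: kN1; have -> : k = (j * r + 1)%N by lia.
  by rewrite modnMDl.
have [|S [cardS dimS]] := @repair_groups F n C r j locC; first by lia.
have cardSC := cardsC S; rewrite card_ord in cardSC.
have shS_ge2 : (2 <= \dim (shorten C S))%N by nia.
have [] := @shorten_MDS F n C S d distC; [by lia | by lia |].
move=> dimC' mdsC' cardC'.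
have := hMDS _ _ _ _ mdsC'.
have nontriv : nontrivial_dim #|~: S| (\dim (restrict F (~: S) @: shorten C S)).
  (* The dimension is at least 2, and [cardC'] with [3 <= d] puts it at least 2 below the length. *)
  by split; lia.
move=> /(_ nontriv) leC'.
have {}leC' : (#|~: S| <= #|F| + 2)%N by move: leC'; case: ifP => _; lia.
(* First bound: [#|S| <= j * r + j <= 2 * k]. Second: [cardC'] and dimension at least 2 give
   [d + 1 <= #|~: S|]. *)
by split; nia.
Qed.

Theorem corollary3p8 (R : realType) (hMDS : main_MDS_conjecture) :
  (forall k : nat, exists c : nat,
     forall (F : finFieldType) (n d r : nat) (C : {vspace 'rV[F]_n}),
       locally_repairable k d r C -> singleton_optimal n k d r ->
       (2 <= r)%N -> (r < k)%N -> (2 * (r + 1) <= n)%N -> (3 <= d)%N ->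
       k <> 1 %[mod r] ->
       (n <= #|F| + c)%N)
  /\
  (forall lambda : R, 0 < lambda < 1 -> exists c : R,
     forall (F : finFieldType) (n k d r : nat) (C : {vspace 'rV[F]_n}),
       locally_repairable k d r C -> singleton_optimal n k d r ->
       (2 <= r)%N -> (r < k)%N -> (2 * (r + 1) <= n)%N -> (3 <= d)%N ->
       k <> 1 %[mod r] ->
       d%:R = lambda * n%:R ->
       n%:R <= #|F|%:R / lambda + c).
Proof.
split=> [k|lambda /andP[lambda_gt0 _]].
  exists (2 * k + 2)%N => F n d r C lrc opt r_ge2 ltrk _ d_ge3 kN1.
  exact: (singleton_optimal_bounds hMDS lrc opt r_ge2 ltrk d_ge3 kN1).1.
(* The constant is the 1 of [d <= #|F| + 1], divided by [lambda]. *)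
exists lambda^-1 => F n k d r C lrc opt r_ge2 ltrk _ d_ge3 kN1 dE.
have [_ led] := singleton_optimal_bounds hMDS lrc opt r_ge2 ltrk d_ge3 kN1.
rewrite -[X in _ + X]mul1r -mulrDl ler_pdivlMr // mulrC -dE.
by rewrite natr1 ler_nat -addn1.
Qed.
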